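(* Let $\mathrm{PERM}_n=\{(\pi(1),\dots,\pi(n))\in\mathbb{Z}^n:\pi\in\mathcal{S}_n\}$, where $\mathcal{S}_n$ is the symmetric group on $[n]$ (the vertex set of the permutahedron). Then $\mathrm{rc}(\mathrm{PERM}_n)=2^{\Theta(n)}$.
   Context: For $X\subseteq\mathbb{Z}^d$, a polyhedron $R\subseteq\mathbb{R}^d$ is called a relaxation for $X$ if $R\cap\mathbb{Z}^d=\mathrm{conv}(X)\cap\mathbb{Z}^d$. The relaxation complexity $\mathrm{rc}(X)$ is the smallest number of facets of any relaxation for $X$. The notation $f(n)=2^{\Theta(n)}$ means there exist constants $c_1,c_2>0$ with $2^{c_1n}\le f(n)\le 2^{c_2n}$ for all sufficiently large $n$. *)

(* Defs.v *)
From HB Require Import structures.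
From mathcomp Require Import all_boot all_order all_fingroup all_algebra.
From mathcomp Require Import all_classical all_reals all_analysis.

Set Implicit Arguments.
Unset Strict Implicit.
Unset Printing Implicit Defensive.

Import Order.TTheory GRing.Theory Num.Theory.
Local Open Scope classical_set_scope.
Local Open Scope card_scope.
Local Open Scope ring_scope.

Section Polyhedra.
Variables (R : realType) (d : nat).
Implicit Types (S P F : set 'cV[R]_d).

Definition convex_hull S : set 'cV[R]_d := smallest (@convex_set R 'cV[R]_d) S.

Definition polyhedron P : Prop :=
  exists m (A : 'M[R]_(m, d)) (b : 'cV[R]_m),
    P = [set x | forall i, (A *m x) i 0 <= b i 0].

Definition affinely_independent k (v : 'I_k -> 'cV[R]_d) : Prop :=
  forall c : 'I_k -> R,
    \sum_i c i = 0 -> \sum_i c i *: v i = 0 -> forall i, c i = 0.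

Definition has_affinely_independent S k : Prop :=
  exists v : 'I_k -> 'cV[R]_d, (forall i, S (v i)) /\ affinely_independent v.

(* The dimension of [S] is one less than the maximal number of affinely
   independent points of [S]; the empty set has no dimension here. *)
Definition has_dim S k : Prop :=
  has_affinely_independent S k.+1 /\ ~ has_affinely_independent S k.+2.

Definition face P F : Prop :=
  exists (a : 'rV[R]_d) (b : R),
    (forall x, P x -> (a *m x) 0 0 <= b) /\
    F = P `&` [set x | (a *m x) 0 0 = b].

(* Nonempty faces of codimension one in [P], which need not be
   full-dimensional; in particular equations of the affine hull of [P] do not
   contribute facets, and a one-point polyhedron has none. *)
Definition facets P : set (set 'cV[R]_d) :=
  [set F | face P F /\ exists k, has_dim F k /\ has_dim P k.+1].

Definition embZ : 'cV[int]_d -> 'cV[R]_d := map_mx intr.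

Definition relaxation (X : set 'cV[int]_d) P : Prop :=
  polyhedron P /\ P `&` range embZ = convex_hull (embZ @` X) `&` range embZ.

(* The infimum is a minimum as soon as [X] has a relaxation, and is [+oo]
   otherwise. *)
Definition rc (X : set 'cV[int]_d) : \bar R :=
  ereal_inf [set (k%:R)%:E | k in
    [set k : nat | exists P, relaxation X P /\ facets P #= `I_k]].

End Polyhedra.

Arguments rc R {d} X.

Definition PERM (n : nat) : set 'cV[int]_n :=
  [set \col_i ((s i).+1)%:Z | s in [set: 'S_n]].
Arguments PERM n : clear implicits.

Definition two_pow_Theta (R : realType) (f : nat -> \bar R) : Prop :=
  exists c1 c2 : R, 0 < c1 /\ 0 < c2 /\
    \forall n \near \oo,
      ((2 `^ (c1 * n%:R))%:E <= f n)%E /\ (f n <= (2 `^ (c2 * n%:R))%:E)%E.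

(* Main.v *)
Require Import Defs.
From mathcomp Require Import all_boot all_order all_fingroup all_algebra.
From mathcomp Require Import all_classical all_reals all_analysis.
From mathcomp Require Import ring lra zify.

(* Upper bound: the inequalities sum_{i in T} x_i >= |T|(|T|+1)/2 (T a set of
   coordinates), together with the reverse inequality for the full set, form a
   relaxation.  An integer point x satisfying them with x_i = x_j is the midpoint
   of x + e_i - e_j and x - e_i + e_j, which still satisfy them and have a larger
   sum of squares; so x reaches convex combinations of permutations after
   finitely many such steps.  A polyhedron has at most as many facets as
   inequalities.

   Lower bound (hiding sets): if points of aff(P) lie outside P but all their
   midpoints lie in P, then each facet inequality of P is violated by at most
   one of them, so P has at least as many facets as there are points.  With
   m = 2p and n > 2m, the points are obtained from the integer vector that is
   m + 1 on the first 2m + 1 coordinates and i in every later coordinate i, by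
   subtracting p + 1 from one member and adding it to the other in each of m
   pairs of coordinates: 2^m choices. *)

Set Implicit Arguments.
Unset Strict Implicit.
Unset Printing Implicit Defensive.

Import Order.TTheory GRing.Theory Num.Theory.
Local Open Scope ring_scope.

(** * Integer points of the permutahedron *)

Lemma double_sum_succ n : (2 * \sum_(i < n) i.+1 = n * n.+1)%N.
Proof. by elim: n => [|n IH]; rewrite ?big_ord0 // big_ord_recr /= mulnDr IH; lia. Qed.

(** The values [i.+1] are distinct integers above [N], so their sum is least for N+1, ..., N+|A|. *)
Lemma double_sum_succ_ge n N (A : {set 'I_n}) : (forall i, i \in A -> (N <= i)%N) ->
  (#|A| * (2 * N + #|A|.+1) <= 2 * \sum_(i in A) i.+1)%N.
Proof.
move=> AN; pose p k := oapp (fun i => i \in A) false (insub k : option 'I_n).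
have pE (i : 'I_n) : p i = (i \in A) by rewrite /p valK.
have pN k : p k -> (N <= k)%N by rewrite /p; case: insubP => //= i _ <- /AN.
(* Induction over initial segments of the indices; the bound on the count shows that the next value
   is at least N + count + 1. *)
have H t : (\sum_(i < t) p i <= t - N)%N /\
    ((\sum_(i < t) p i) * (2 * N + (\sum_(i < t) p i).+1)
     <= 2 * \sum_(i < t) p i * i.+1)%N.
  elim: t => [|t]; first by rewrite !big_ord0.
  rewrite !big_ord_recr /=; have := pN t; case: (p t) => /= [/(_ isT)|_];
    move: (\sum_(i < t) _)%N (\sum_(i < t) _)%N => a b; nia.
have E (F : 'I_n -> nat) : (\sum_(i < n) p i * F i = \sum_(i in A) F i)%N.
  rewrite [RHS]big_mkcond; apply: eq_bigr => i _; rewrite pE.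
  by case: ifP; rewrite ?mul1n.
have [_] := H n; rewrite (E (fun i => i.+1)).
have -> : (\sum_(i < n) p i = #|A|)%N.
  by rewrite -sum1_card -E; apply: eq_bigr => i _; rewrite muln1.
by [].
Qed.

Lemma big_in_setT (V : nmodType) (I : finType) (F : I -> V) :
  \sum_(i in [set: I]) F i = \sum_i F i.
Proof. by apply: eq_bigl => i; rewrite inE. Qed.

Section Permutahedron.
Variable n : nat.
Implicit Types (x : 'cV[int]_n) (T : {set 'I_n}).

(* Both sides are doubled to stay in the integers. *)
Definition perm_ineqs x : Prop :=
  (forall T, (#|T| * #|T|.+1)%:Z <= 2 * \sum_(i in T) x i 0) /\
  2 * \sum_i x i 0 <= (n * n.+1)%:Z.

Lemma perm_ineqs_PERM x : PERM n x -> perm_ineqs x.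
Proof.
have sumZ (Q : pred 'I_n) (s : 'S_n) : \sum_(i | Q i) (\col_i ((s i).+1)%:Z) i 0 =
    (\sum_(i | Q i) (s i).+1)%N%:Z :> int.
  by rewrite (big_morph Posz PoszD erefl); apply: eq_bigr => i _; rewrite mxE.
move=> [s _ <-]; split=> [T|]; rewrite sumZ -PoszM lez_nat.
  have := @double_sum_succ_ge n 0 (s @: T) (fun _ _ => isT).
  by rewrite card_imset ?big_imset; [|exact: (in2W perm_inj)|exact: perm_inj].
by rewrite -double_sum_succ [in X in (_ <= X)%N](reindex_inj (@perm_inj _ s)).
Qed.

Lemma perm_ineqs_total x : perm_ineqs x -> 2 * \sum_i x i 0 = (n * n.+1)%:Z.
Proof.
move=> [/(_ [set: 'I_n]) xT xn]; apply/eqP; rewrite eq_le xn /=.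
by move: xT; rewrite cardsT card_ord big_in_setT.
Qed.

(** The lower bound is the inequality of a singleton; the upper bound subtracts that of its
    complement from the total. *)
Lemma perm_ineqs_bounds x i : perm_ineqs x -> 1 <= x i 0 /\ x i 0 <= n%:Z.
Proof.
move=> xP; have xn := perm_ineqs_total xP; have [xT _] := xP.
have := xT [set i]; have := xT [set~ i].
have -> : \sum_(k in [set~ i]) x k 0 = \sum_k x k 0 - x i 0.
  rewrite [in RHS](bigD1 i) //= addrAC subrr add0r.
  by apply: eq_bigl => k; rewrite !inE.
rewrite cardsC1 cards1 big_set1 card_ord.
rewrite mulrBr xn; move: (x i 0) => y.
have -> : n = n.-1.+1 by rewrite prednK // (leq_ltn_trans _ (ltn_ord i)).
by move: n.-1 => n' /=; split; nia.
Qed.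

Lemma sum_delta T i : \sum_(k in T) (k == i)%:R = (i \in T)%:R :> int.
Proof.
case: (boolP (i \in T)) => iT.
  rewrite (bigD1 i) //= eqxx big1 ?addr0 // => k /andP[_ /negPf -> //].
by rewrite big1 // => k kT; case: eqP => // ki; rewrite -ki kT in iT.
Qed.

Definition transfer i j x : 'cV[int]_n := \col_k (x k 0 + (k == i)%:R - (k == j)%:R).

Lemma perm_ineqs_transfer x i j : perm_ineqs x -> i != j -> x i 0 = x j 0 ->
  perm_ineqs (transfer i j x).
Proof.
move=> [xT xn] ij xij.
have E T : \sum_(k in T) transfer i j x k 0 =
    \sum_(k in T) x k 0 + (i \in T)%:R - (j \in T)%:R.
  under eq_bigr do rewrite mxE.
  by rewrite sumrB big_split /= !sum_delta.
split=> [T|]; last first.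
  by have := E [set: 'I_n]; rewrite !inE addrK !big_in_setT => ->.
rewrite E; have := xT T; case: (boolP (j \in T)) => jT; last first.
  by case: (i \in T); rewrite /=; lia.
case: (boolP (i \in T)) => iT /=; first by lia.
(* The only case in which the sum drops: [T] contains [j] but not [i]. *)
have := xT (i |: T); have := xT (T :\ j).
rewrite cardsU1 iT big_setU1 //= (cardsD1 j T) jT.
rewrite [\sum_(k in T) _](big_setD1 j) //= -xij.
move: (\sum_(_ in _) _) (x i 0) #|_| => S y s.
(* Adding the inequalities of i |: T and T :\ j gives the required one up to 1;
   the parity of |T|(|T|+1) supplies the missing unit. *)
have [q qE] : exists q, (s.+1 * s.+2 = 2 * q)%N.
  by exists (\sum_(i < s.+1) i.+1)%N; rewrite double_sum_succ.
rewrite !add1n; nia.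
Qed.
End Permutahedron.

(** * The hiding set *)

Section HidingPoints.
Variables (n p : nat).
Let m := (2 * p)%N.
Hypothesis mn : (2 * m < n)%N.
Implicit Types (u t : nat -> int) (T : {set 'I_n}).

(** Coordinates [k] and [k + m] form a pair and receive opposite values, so the total is 0. *)
Definition spread u k : int :=
  if (k < m)%N then u k else if (k < 2 * m)%N then - u (k - m)%N else 0.

(** The values 1, ..., n with the first 2m+1 of them replaced by their mean m+1, which preserves the
    total. *)
Definition plateau k : nat := if (k <= 2 * m)%N then m.+1 else k.+1.

(* [hpoint u] is the midpoint of two hiding points when [u] is the mean of their
   sign vectors. *)
Definition hpoint u : 'cV[int]_n :=
  \col_i ((plateau i)%:Z - p.+1%:Z * spread u i).

Lemma sum_pairs (F : nat -> int) : (forall k, (2 * m <= k)%N -> F k = 0) ->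
  \sum_(i < n) F i = \sum_(k < m) (F k + F (k + m)%N).
Proof.
move=> F0; rewrite -(big_mkord xpredT F) (@big_cat_nat _ _ _ (2 * m)) ?(ltnW mn) //=.
have -> : \sum_(2 * m <= i < n) F i = 0.
  by rewrite big_nat big1 // => i /andP[/F0].
rewrite addr0.
rewrite (@big_cat_nat _ _ _ m) ?mul2n -?addnn ?leq_addr //=.
rewrite -{2}[m]add0n big_addn addnK !big_mkord.
by rewrite -big_split.
Qed.

Lemma spread_pair u k : (k < m)%N -> spread u k = u k /\ spread u (k + m) = - u k.
Proof.
move=> km; rewrite /spread km; split=> //.
have -> : (k + m < m)%N = false by lia.
have -> : (k + m < 2 * m)%N by lia.
by rewrite addnK.
Qed.

Lemma spread_ge u k : (2 * m <= k)%N -> spread u k = 0.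
Proof.
by move=> mk; rewrite /spread !ifF //; lia.
Qed.

Lemma sum_spread u : \sum_(i < n) spread u i = 0.
Proof.
rewrite (sum_pairs (@spread_ge u)) big1 // => k _.
by have [-> ->] := spread_pair u (ltn_ord k); rewrite subrr.
Qed.

Lemma double_sum_plateau : (2 * \sum_(i < n) plateau i = n * n.+1)%N.
Proof.
have H d : (2 * \sum_(i < (2 * m).+1 + d) plateau i
    = ((2 * m).+1 + d) * ((2 * m).+1 + d).+1)%N.
  elim: d => [|d IH].
    rewrite addn0 (eq_bigr (fun=> m.+1)).
      by rewrite sum_nat_const card_ord; lia.
    by move=> i _; rewrite /plateau -ltnS ltn_ord.
  rewrite addnS big_ord_recr /= mulnDr IH /plateau ifF; lia.
by rewrite -(subnKC mn) H.
Qed.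

Lemma hpoint_total u : 2 * \sum_i hpoint u i 0 = (n * n.+1)%:Z.
Proof.
under eq_bigr do rewrite mxE.
rewrite sumrB -mulr_sumr sum_spread mulr0 subr0 -double_sum_plateau PoszM.
by rewrite (big_morph Posz PoszD erefl).
Qed.

(** One member of each pair is lowered to m+1-(p+1) = p. These m coordinates have doubled sum 4p^2,
    short of the required m(m+1) = 4p^2+2p. *)
Lemma hpoint_notin u : (0 < p)%N -> (forall k, (k < m)%N -> u k = 1 \/ u k = -1) ->
  ~ perm_ineqs (hpoint u).
Proof.
move=> p0 u1 [/(_ [set i : 'I_n | spread u i == 1]) + _].
set T := [set i | _].
have cT : #|T|%:Z = m%:Z.
  rewrite -sum1_card (big_morph Posz PoszD erefl) big_mkcond /=.
  rewrite (eq_bigr (fun i : 'I_n => (spread u i == 1)%:R)); last first.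
    by move=> i _; rewrite inE; case: eqP.
  rewrite (sum_pairs (F := fun k => (spread u k == 1)%:R)); last first.
    by move=> k /spread_ge ->.
  rewrite (eq_bigr (fun=> 1)).
    by rewrite sumr_const card_ord -natz.
  move=> k _; have [-> ->] := spread_pair u (ltn_ord k).
  by have [->|->] := u1 k (ltn_ord k).
rewrite (eq_bigr (fun=> p%:Z)); last first.
  move=> i; rewrite inE mxE => /eqP si; rewrite si /plateau.
  case: ifP => im; first by rewrite /m; lia.
  by rewrite spread_ge in si; lia.
have -> : \sum_(i in T) p%:Z = p%:Z * m%:Z by rewrite sumr_const -cT -mulr_natr natz.
rewrite PoszM -[#|T|.+1]addn1 PoszD cT /m; nia.
Qed.

Lemma sum_indicator_card T (F : pred nat) : \sum_(i in T) (F i)%:R = #|[set i in T | F i]|%:Z.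
Proof.
rewrite -sum1_card (big_morph Posz PoszD erefl) [LHS]big_mkcond [RHS]big_mkcond /=.
by apply: eq_bigr => i _; rewrite inE; case: (i \in T) => //=; case: (F i).
Qed.

(** Let [T] have [s] members below [N] and [r] others, and let [e] be the sum of [spread u] over
    [T]. Since 2(p+1) = m+2, the doubled inequality for [T] has slack at least (s+2r)(N-s) - (m+2)e.
    The zero at [k0] bounds [e] by m-1, which keeps this nonnegative. *)
Lemma perm_ineqs_hpoint u k0 : (k0 < m)%N -> u k0 = 0 ->
  (forall k, (k < m)%N -> -1 <= u k /\ u k <= 1) -> perm_ineqs (hpoint u).
Proof.
move=> k0m u0 u1; split; last by rewrite hpoint_total.
move=> T; set N := (2 * m).+1.
have s1 k : spread u k <= (k < N)%:R /\ - (k < N)%:R <= spread u k.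
  rewrite /spread; case: ifP => [km|_].
    by have [] := u1 k km; have -> : (k < N)%N by rewrite /N; lia.
  case: ifP => [km|_]; last by case: (k < N)%N.
  have -> : (k < N)%N by rewrite /N; lia.
  by have [] := u1 (k - m)%N; lia.
pose T1 := [set i in T | (i < N)%N]; pose T2 := [set i in T | (N <= i)%N].
have cT : #|T|%:Z = #|T1|%:Z + #|T2|%:Z.
  rewrite -(sum_indicator_card T (fun k => k < N)%N).
  rewrite -(sum_indicator_card T (fun k => N <= k)%N) -big_split /=.
  rewrite -sum1_card (big_morph Posz PoszD erefl).
  by apply: eq_bigr => i _; case: ltnP.
set s := #|T1|%:Z in cT; set r := #|T2| in cT.
pose e := \sum_(i in T) spread u i.
have es : e <= s.
  by rewrite /s -(sum_indicator_card T (fun k => k < N)%N); apply: ler_sum => i _; have [] := s1 i.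
have sN : \sum_(i < n) (i < N)%:R = N%:Z.
  rewrite -(big_mkord xpredT (fun i => (i < N)%:R)) (@big_cat_nat _ _ _ N) //=.
  have -> : \sum_(N <= i < n) (i < N)%:R = 0 :> int.
    by rewrite big_nat big1 // => i; rewrite leqNgt => /andP[/negPf ->].
  rewrite addr0 big_nat (eq_bigr (fun=> 1)); last by move=> i /andP[_ ->].
  by rewrite -big_nat sumr_const_nat subn0 natz.
(* As [spread u] sums to 0, [e] is minus the sum outside [T], where N-s of the first [N] coordinates
   lie. *)
have eNs : e <= N%:Z - s.
  rewrite /s -(sum_indicator_card T (fun k => k < N)%N) -sN.
  have -> : e = - \sum_(i < n | i \notin T) spread u i.
    apply/eqP; rewrite -addr_eq0; apply/eqP.
    by have := sum_spread u; rewrite (bigID (mem T)).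
  rewrite [X in _ <= X - _](bigID (mem T)) /= addrAC subrr add0r -sumrN.
  by apply: ler_sum => i _; have [] := s1 i; lia.
(* A pair of opposite entries adds at most 1 to the sum of positive parts, and the pair of [k0] adds
   nothing. *)
have em : e <= m%:Z - 1.
  apply: (@le_trans _ _ (\sum_(i < n) Num.max (spread u i) 0)).
    rewrite [leRHS](bigID (mem T)) /= -[e]addr0; apply: lerD.
      by apply: ler_sum => i _; rewrite le_max lexx.
    by apply: sumr_ge0 => i _; rewrite le_max lexx orbT.
  rewrite (sum_pairs (F := fun k => Num.max (spread u k) 0)); last first.
    by move=> k /spread_ge ->.
  apply: (@le_trans _ _ (\sum_(k < m) (k != Ordinal k0m)%:R)).
    apply: ler_sum => k _; have [-> ->] := spread_pair u (ltn_ord k).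
    have := u1 k (ltn_ord k); case: eqP => [->|_] /=; first by rewrite u0.
    by case; lia.
  rewrite (bigD1 (Ordinal k0m)) //= eqxx add0r (eq_bigr (fun=> 1)); last first.
    by move=> k ->.
  by rewrite sumr_const cardC1 card_ord; lia.
have sr : 2 * \sum_(i in T) (plateau i)%:Z >= 2 * s * m.+1%:Z + r%:Z * (2 * N%:Z + r%:Z + 1).
  have -> : \sum_(i in T) (plateau i)%:Z = s * m.+1%:Z + (\sum_(i in T2) i.+1)%N%:Z.
    rewrite /s -(sum_indicator_card T (fun k => k < N)%N) mulr_suml (big_morph Posz PoszD erefl).
    rewrite [X in _ = _ + X]big_mkcond [X in _ = X + _]big_mkcond -big_split big_mkcond.
    apply: eq_bigr => i _; rewrite inE /plateau; case: (i \in T) => //=.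
    by rewrite ltnS; case: leqP => _; rewrite ?mul1r ?mul0r ?addr0 ?add0r.
  have T2N i : i \in T2 -> (N <= i)%N by rewrite inE => /andP[].
  by have := double_sum_succ_ge T2N; rewrite -/r; lia.
have -> : \sum_(i in T) hpoint u i 0 = \sum_(i in T) (plateau i)%:Z - p.+1%:Z * e.
  by under eq_bigr do rewrite mxE; rewrite sumrB -mulr_sumr.
have s0 : 0 <= s by [].
have sN' : s <= N%:Z.
  rewrite /s -(sum_indicator_card T (fun k => k < N)%N) -sN.
  by rewrite [leRHS](bigID (mem T)) /= lerDl sumr_ge0.
(* s(N - s) - e(N - e) = (s - e)(N - s - e) >= 0 and N - e >= m + 2. *)
have key : s * (N%:Z - s) >= (m%:Z + 2) * e.
  have [e0|e0] := lerP e 0; first by nia.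
  have : (s - e) * (N%:Z - s - e) >= 0 by apply: mulr_ge0; lia.
  have : e * (m%:Z - 1 - e) >= 0 by apply: mulr_ge0; lia.
  rewrite /N; nia.
have : r%:Z * (N%:Z - s) >= 0 by apply: mulr_ge0; lia.
rewrite PoszM -[#|T|.+1]addn1 PoszD cT; move: sr key; rewrite /N /m.
nia.
Qed.
End HidingPoints.

Local Open Scope classical_set_scope.
Local Open Scope card_scope.

(** * Affine bases and facets *)

Section Homogenization.
Variables (R : realType) (d : nat).
Implicit Types (S P F : set 'cV[R]_d) (x y z : 'cV[R]_d) (c : 'cV[R]_(d + 1)).

(* The affine functions on R^d are [ev ^~ c]: the last entry of [c] is the
   constant term.  Affine notions for points become linear ones for lifts. *)
Definition lift x : 'rV[R]_(d + 1) := row_mx x^T 1%:M.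

Definition ev x c : R := (lift x *m c) 0 0.

Lemma lift_conv x y (t : R) :
  lift (x + t *: (y - x)) = lift x + t *: (lift y - lift x).
Proof.
rewrite /lift opp_row_mx add_row_mx subrr scale_row_mx scaler0 add_row_mx addr0.
by rewrite linearD linearZ linearB.
Qed.

Lemma ev_conv x y t c : ev (x + t *: (y - x)) c = ev x c + t * (ev y c - ev x c).
Proof.
by rewrite /ev lift_conv mulmxDl -scalemxAl mulmxBl !mxE.
Qed.

Lemma lift_lsubmx (r : 'rV[R]_(d + 1)) : rsubmx r = 1%:M -> lift (lsubmx r)^T = r.
Proof. by move=> r1; rewrite /lift trmxK -r1 hsubmxK. Qed.

Lemma evE x c : ev x c = ((usubmx c)^T *m x) 0 0 + dsubmx c 0 0.
Proof.
rewrite /ev -[in LHS](vsubmxK c) mul_row_col mul1mx mxE; congr (_ + _).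
by rewrite -[usubmx c in LHS]trmxK -trmx_mul mxE.
Qed.

Lemma ev_col_mx x (a : 'rV[R]_d) b : ev x (col_mx a^T (- b)%:M) = (a *m x) 0 0 - b.
Proof. by rewrite evE col_mxKu col_mxKd trmxK [X in _ + X]mxE eqxx mulr1n. Qed.

Lemma col_mxP c : exists (a : 'rV[R]_d) b, c = col_mx a^T (- b)%:M.
Proof.
exists (usubmx c)^T, (- dsubmx c 0 0).
by rewrite trmxK opprK -mx11_scalar vsubmxK.
Qed.

Lemma polyhedronP P : polyhedron P <->
  exists m (c : 'I_m -> 'cV[R]_(d + 1)), P = [set x | forall i, ev x (c i) <= 0].
Proof.
split.
- move=> [m [A [b ->]]]; exists m, (fun i => col_mx (row i A)^T (- b i 0)%:M).
  apply/seteqP; split=> x /= Px i; have := Px i;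
    by rewrite ev_col_mx subr_le0 -row_mul [row _ _ 0 0]mxE.
- move=> [m [c ->]].
  pose A := \matrix_i (usubmx (c i))^T; pose b := \col_i - dsubmx (c i) 0 0.
  exists m, A, b.
  have E x i : ((A *m x) i 0 <= b i 0) = (ev x (c i) <= 0).
    have -> : (A *m x) i 0 = ((usubmx (c i))^T *m x) 0 0.
      transitivity ((row i (A *m x)) 0 0); first by rewrite [RHS]mxE.
      by rewrite row_mul rowK.
    by rewrite evE [b i 0]mxE -subr_le0 opprK.
  by apply/seteqP; split=> x /= Px i; have := Px i; rewrite E.
Qed.

Lemma polyhedron_finType (J : finType) (c : J -> 'cV[R]_(d + 1)) :
  polyhedron [set x | forall j, ev x (c j) <= 0].
Proof.
apply/polyhedronP; exists #|J|, (fun i => c (enum_val i)).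
apply/seteqP; split=> x /= Px i; first exact: Px.
by rewrite -[i]enum_rankK; apply: Px.
Qed.

Lemma faceP P F : face P F <->
  exists c, (forall x, P x -> ev x c <= 0) /\ F = P `&` [set x | ev x c = 0].
Proof.
split.
- move=> [a [b [Pab ->]]]; exists (col_mx a^T (- b)%:M); split.
    by move=> x Px; rewrite ev_col_mx subr_le0 Pab.
  apply/seteqP; split=> x /= [Px]; rewrite ev_col_mx.
    by move->; rewrite subrr.
  by move/subr0_eq.
- move=> [c []]; have [a [b ->]] := col_mxP c => Pc ->; exists a, b; split.
    by move=> x /Pc; rewrite ev_col_mx subr_le0.
  apply/seteqP; split=> x /= [Px]; rewrite ev_col_mx.
    by move/subr0_eq.
  by move->; rewrite subrr.
Qed.

(** Dimension [k] corresponds to [k.+1] rows; the empty set has the basis without rows. *)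
Definition affine_basis S k (V : 'M[R]_(k, d + 1)) :=
  [/\ row_free V, forall i, exists2 x, S x & row i V = lift x &
      forall x, S x -> (lift x <= V)%MS].

(** The final entries of the lifts, all 1, encode the condition that the coefficients sum to 0. *)
Lemma affinely_independentP k (v : 'I_k -> 'cV[R]_d) :
  affinely_independent v <-> row_free (\matrix_i lift (v i)).
Proof.
have E (u : 'rV_k) :
    u *m (\matrix_i lift (v i)) = row_mx (\sum_i u 0 i *: v i)^T (\sum_i u 0 i)%:M.
  rewrite mulmx_sum_row; elim/big_rec3: _ => [|i y1 y2 y3 _ ->].
    by rewrite trmx0 raddf0 row_mx0.
  rewrite rowK /lift scale_row_mx scale_scalar_mx mulr1 add_row_mx.
  by rewrite linearD linearZ raddfD.
split=> [vI|/row_free_inj Vf c c0 cv i].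
  apply: inj_row_free => u; rewrite E -[X in _ = X -> _]row_mx0 => /eq_row_mx [].
  move/(congr1 trmx); rewrite trmxK trmx0 => uv /(congr1 (fun M : 'M[R]_1 => M 0 0)).
  rewrite !mxE mulr1n => u0; apply/rowP => i; rewrite mxE.
  exact: (vI (u 0)).
have := Vf 1%N (\row_i c i) 0; rewrite mul0mx E.
have -> : \sum_i (\row_i c i) 0 i *: v i = 0.
  by rewrite -[RHS]cv; apply: eq_bigr => j _; rewrite mxE.
have -> : \sum_i (\row_i c i) 0 i = 0.
  by rewrite -[RHS]c0; apply: eq_bigr => j _; rewrite mxE.
rewrite trmx0 raddf0 row_mx0 => /(_ erefl) /rowP /(_ i).
by rewrite !mxE.
Qed.

Lemma has_affinely_independentP S k : has_affinely_independent S k <->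
  exists2 V : 'M[R]_(k, d + 1), row_free V &
    forall i, exists2 x, S x & row i V = lift x.
Proof.
split=> [[v [Sv /affinely_independentP vf]]|[V Vf SV]].
  by exists (\matrix_i lift (v i)) => // i; exists (v i); rewrite ?rowK.
have /choice [v Sv] : forall i, exists x, S x /\ row i V = lift x.
  by move=> i; have [x Sx e] := SV i; exists x.
exists v; split=> [i|]; first by case: (Sv i).
apply/affinely_independentP; suff -> : \matrix_i lift (v i) = V by [].
by apply/row_matrixP => i; rewrite rowK; case: (Sv i).
Qed.
End Homogenization.

(** * Affine bases, dimension and relative interior points *)

Section Dimension.
Variables (R : realType) (d : nat).
Implicit Types (S P F : set 'cV[R]_d) (x y z : 'cV[R]_d) (c : 'cV[R]_(d + 1)).

(** If the lift of a point of [S] lay outside the row space, appending it would give a larger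
    independent family. *)
Lemma has_affinely_independent_basis S k (V : 'M[R]_(k, d + 1)) :
  row_free V -> (forall i, exists2 x, S x & row i V = lift x) ->
  ~ has_affinely_independent S k.+1 -> affine_basis S V.
Proof.
move=> Vf SV NS; split=> // x Sx; apply: contrapT => /negP xV; apply: NS.
rewrite -addn1; apply/has_affinely_independentP; exists (col_mx V (lift x)).
  rewrite /row_free eqn_leq rank_leq_row /= [in leqLHS]addn1.
  rewrite -[X in (X < _)%N](eqP Vf) -addsmxE.
  have : (V < V + lift x)%MS by rewrite ltmxE addsmxSl addsmx_sub submx_refl.
  by rewrite ltmxErank => /andP[].
move=> i; case: (split_ordP i) => j ->.
  by rewrite rowKu.
by exists x; rewrite // rowKd [j]ord1 row_id.
Qed.

Lemma exists_affine_basis S : exists k (V : 'M[R]_(k, d + 1)), affine_basis S V.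
Proof.
have S0 : exists k, `[< has_affinely_independent S k >].
  exists 0%N; apply/asboolP/has_affinely_independentP.
  by exists 0 => [|[]//]; rewrite /row_free mxrank0.
have Sd k : `[< has_affinely_independent S k >] -> (k <= d + 1)%N.
  move=> /asboolP /has_affinely_independentP [V Vf _].
  by rewrite -(eqP Vf) rank_leq_col.
case: (ex_maxnP S0 Sd) => k /asboolP /has_affinely_independentP [V Vf SV] kmax.
exists k, V; apply: has_affinely_independent_basis => // /asboolP /kmax.
by rewrite ltnn.
Qed.

Lemma has_dimP S k : has_dim S k <->
  exists V : 'M[R]_(k.+1, d + 1), affine_basis S V.
Proof.
split=> [[/has_affinely_independentP [V Vf SV] NS]|[V [Vf SV VS]]].
  by exists V; apply: has_affinely_independent_basis.
split; first by apply/has_affinely_independentP; exists V.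
move=> /has_affinely_independentP [W Wf SW].
suff : (W <= V)%MS by move=> /mxrankS; rewrite (eqP Wf) (eqP Vf) ltnn.
by apply/row_subP => i; have [x Sx ->] := SW i; apply: VS.
Qed.

Lemma affine_basis_ev0 S k (V : 'M[R]_(k, d + 1)) c : affine_basis S V ->
  (forall x, S x -> ev x c = 0) <-> V *m c = 0.
Proof.
move=> [Vf SV VS]; split=> [Sc|Vc x /VS /submxP [D xD]].
  apply/row_matrixP => i; rewrite row_mul; have [x /Sc xc ->] := SV i.
  by rewrite row0 [LHS]mx11_scalar -/(ev x c) xc raddf0.
by rewrite /ev xD -mulmxA Vc mulmx0 mxE.
Qed.

Lemma submx_ev x k (V : 'M[R]_(k, d + 1)) c :
  (lift x <= V)%MS -> V *m c = 0 -> ev x c = 0.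
Proof. by move=> /submxP [D xD] Vc; rewrite /ev xD -mulmxA Vc mulmx0 mxE. Qed.

Lemma submx_lift x k (V : 'M[R]_(k, d + 1)) :
  (forall c, V *m c = 0 -> ev x c = 0) -> (lift x <= V)%MS.
Proof.
move=> Vx; rewrite submxE; apply/eqP/rowP => j.
rewrite [RHS]mxE -[RHS](Vx (col j (cokermx V))).
  rewrite /ev [LHS]mxE [RHS]mxE.
  by apply: eq_bigr => i _; rewrite [col _ _ _ _]mxE.
by rewrite colE mulmxA mulmx_coker mul0mx.
Qed.

(* [y] is the barycenter of an affine basis, a relative interior point. *)
Lemma centroid S k (V : 'M[R]_(k.+1, d + 1)) : affine_basis S V ->
  exists y, (lift y <= V)%MS /\
    forall c, (forall x, S x -> ev x c <= 0) ->
      ev y c <= 0 /\ (V *m c != 0 -> ev y c < 0).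
Proof.
move=> [Vf SV VS]; pose t : R := k.+1%:R^-1.
have t0 : 0 < t by rewrite invr_gt0 ltr0n.
pose r : 'rV[R]_(d + 1) := const_mx t *m V.
(* Every row of [V] ends in 1, so their average does too and is again a lift. *)
have r1 : rsubmx r = 1%:M.
  have V1 i : V i (rshift d 0) = 1.
    have [x _ /rowP /(_ (rshift d 0))] := SV i.
    by rewrite [LHS]mxE => ->; rewrite row_mxEr mxE.
  apply/rowP => j; rewrite [j]ord1 !mxE.
  under eq_bigr do rewrite mxE V1 mulr1.
  by rewrite sumr_const card_ord -mulr_natl mulfV // pnatr_eq0.
exists (lsubmx r)^T; rewrite /ev lift_lsubmx //; split; first exact: submxMl.
move=> c Sc.
have Vc i : (V *m c) i 0 <= 0.
  have [x /Sc] := SV i; rewrite /ev => + e.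
  by rewrite -e -row_mul [X in X <= _]mxE.
have -> : (r *m c) 0 0 = t * \sum_i (V *m c) i 0.
  rewrite /r -mulmxA [LHS]mxE mulr_sumr; apply: eq_bigr => i _.
  by rewrite [X in X * _]mxE.
have s0 : \sum_i (V *m c) i 0 <= 0 by apply: sumr_le0.
rewrite pmulr_rle0 // pmulr_rlt0 //; split=> // Vc0; rewrite lt_neqAle s0 andbT.
apply: contra Vc0 => /eqP s0'; apply/eqP/colP => i; rewrite [RHS]mxE.
apply/eqP; rewrite eq_le Vc /= -s0' (bigD1 i) //= gerDl.
by apply: sumr_le0.
Qed.
End Dimension.

Lemma finType_card_le (J : finType) T (A : set T) k (f : J -> T) :
  injective f -> (forall j, A (f j)) -> A #= `I_k -> (#|J| <= k)%N.
Proof.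
move=> finj Af Ak; pose g (i : 'I_#|J|) := f (enum_val i).
have ginj : injective g by apply: inj_comp finj _; apply: enum_val_inj.
rewrite -card_le_II.
have /card_le_trans : `I_#|J| #<= [set: 'I_#|J|].
  by have := @card_II #|J|; rewrite card_eq_le => /andP[].
apply; have /card_le_trans : [set: 'I_#|J|] #<= g @` [set: 'I_#|J|].
  have : g @` [set: 'I_#|J|] #= [set: 'I_#|J|] by apply: inj_card_eq => ? ? _ _ /ginj.
  by rewrite card_eq_le => /andP[].
apply; have /card_le_trans : g @` [set: 'I_#|J|] #<= A.
  by apply: subset_card_le => _ [i _ <-]; apply: Af.
by apply; move: Ak; rewrite card_eq_le => /andP[].
Qed.

(** * Facets versus defining inequalities *)

Section Facets.
Variables (R : realType) (d : nat).
Implicit Types (S P F : set 'cV[R]_d) (x y z : 'cV[R]_d).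

(** A short step from a point of a polyhedron, in a direction that raises no tight constraint, stays
    inside. The number [s] exceeds every |v j / u j|; where [u j] is 0 the quotient is 0 and the
    sign hypothesis applies. *)
Lemma small_step (J : finType) (u v : J -> R) :
  (forall j, u j <= 0) -> (forall j, u j = 0 -> v j <= 0) ->
  exists2 e : R, 0 < e & forall j, u j + e * v j <= 0.
Proof.
move=> u0 uv; pose s : R := 1 + \sum_j `|v j / u j|.
have s0 : 0 < s by rewrite ltr_pwDl // sumr_ge0.
exists s^-1 => [|j]; first by rewrite invr_gt0.
have [uj0|uj0] := eqVneq (u j) 0.
  by rewrite uj0 add0r pmulr_rle0 ?invr_gt0 // uv.
have uj : 0 < `|u j| by rewrite normr_gt0.
have : `|v j / u j| <= s.
  rewrite /s (bigD1 j) //= addrCA lerDl addr_ge0 // sumr_ge0 //.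
rewrite normrM normfV ler_pdivrMr // -ler_pdivrMl // (ler0_norm (u0 j)).
move=> uj_ge; have : s^-1 * v j <= s^-1 * `|v j|.
  by rewrite ler_pM2l ?invr_gt0 // ler_norm.
lra.
Qed.

(** Let [y] be the barycenter of a basis of [F]. A row tight at [y] but not zero on all of [P]
    vanishes on [F], and by dimension its zero set in aff(P) is aff(F). If there is no such row, [P]
    extends beyond [y] to points where [a] is positive, a contradiction. *)
Lemma facet_eq_row m (c : 'I_m -> 'cV[R]_(d + 1)) F
    (P := [set x | forall i, ev x (c i) <= 0]) :
  facets P F -> exists i, F = P `&` [set x | ev x (c i) = 0].
Proof.
move=> [/faceP [a [Pa FE]] [k [/has_dimP [V VF] /has_dimP [U UP]]]].
have [y [yV yc]] := centroid VF.
have FP x : F x -> P x by rewrite FE => -[].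
have Va : V *m a = 0 by apply/(affine_basis_ev0 a VF) => x; rewrite FE => -[].
have Py : P y by move=> i; apply: (yc (c i) _).1 => x /FP; apply.
have [Vf SV VS] := VF; have [Uf SU US] := UP.
have VU : (V <= U)%MS.
  by apply/row_subP => i; have [x /FP Px ->] := SV i; apply: US.
have UV : ~ (U <= V)%MS.
  by move/mxrankS; rewrite (eqP Uf) (eqP Vf) ltnn.
case: (pickP [pred i | (ev y (c i) == 0) && (U *m c i != 0)]) => [i|yU].
- move=> /andP [/eqP yi Ui]; exists i.
  have Vi : V *m c i = 0.
    apply/eqP; apply: contraT => Vi.
    by have := (yc (c i) (fun x Fx => FP x Fx i)).2 Vi; rewrite yi ltxx.
  have VW : (V <= U :&: kermx (c i))%MS by rewrite sub_capmx VU; apply/sub_kermxP.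
  (* Intersecting with the kernel of a row that is nonzero on [U] costs one dimension, leaving that
     of [V]. *)
  have WV : (U :&: kermx (c i) <= V)%MS.
    rewrite -(geq_leqif (mxrank_leqif_sup VW)) (eqP Vf).
    have := mxrank_mul_ker U (c i); rewrite (eqP Uf) => rE.
    rewrite -ltnS -[X in (_ < X)%N]rE -add1n leq_add2r lt0n mxrank_eq0.
    exact: Ui.
  apply/seteqP; split=> x.
    by move=> Fx; split; [apply: FP|apply: (affine_basis_ev0 (c i) VF).2 Vi x Fx].
  move=> [Px /= xi]; rewrite FE; split=> //=; apply: submx_ev Va.
  apply: submx_trans WV; rewrite sub_capmx US //=; apply/sub_kermxP.
  by rewrite [LHS]mx11_scalar -/(ev _ _) xi raddf0.
- have [z Pz za] : exists2 z, P z & ev z a < 0.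
    apply: contrapT => NP; apply: UV.
    apply/row_subP => i; have [x Px ->] := SU i; apply: VS; rewrite FE; split=> //=.
    apply/eqP; rewrite eq_le Pa //= leNgt; apply/negP => xa; apply: NP.
    by exists x.
  have ya : ev y a = 0 by apply: submx_ev Va.
  have [|i yi|e e0 ye] := @small_step _ (fun i => ev y (c i))
      (fun i => - (ev z (c i) - ev y (c i))).
  + by move=> i; apply: Py.
  + have /= := yU i; rewrite yi eqxx /= => /negbFE /eqP.
    move=> /(affine_basis_ev0 (c i) UP) Uc.
    by rewrite Uc // subr0 oppr0.
  (* A small step from [y] away from [z] stays in [P] yet makes [a] positive. *)
  + have : P (y + (- e) *: (z - y)).
      by move=> i; rewrite ev_conv mulNr -mulrN.
    move=> /Pa; rewrite ev_conv ya subr0 add0r mulNr oppr_le0 pmulr_rge0 //.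
    by rewrite leNgt za.
Qed.

Lemma facets_card m (c : 'I_m -> 'cV[R]_(d + 1)) :
  exists2 k, (k <= m)%N & facets [set x | forall i, ev x (c i) <= 0] #= `I_k.
Proof.
set P := [set x | _].
have H : facets P #<= `I_m.
  have /card_le_trans : facets P #<=
      (fun i => P `&` [set x | ev x (c i) = 0]) @` [set: 'I_m].
    by apply: subset_card_le => F /facet_eq_row [i ->]; exists i.
  apply; apply: card_le_trans (card_image_le _ _) _.
  by have := @card_II m; rewrite card_eq_le => /andP[].
have /finite_setP [k kP] : finite_set (facets P) by apply: card_le_finite H _.
exists k => //; rewrite -card_le_II.
by move: kP; rewrite card_eq_le => /andP[_ /card_le_trans]; apply.
Qed.

Lemma lift_last x : lift x 0 (rshift d 0) = 1.
Proof. by rewrite row_mxEr mxE. Qed.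

Lemma lift_neq0 x : lift x != 0.
Proof.
by apply/eqP => /rowP /(_ (rshift d 0)) /eqP; rewrite lift_last mxE oner_eq0.
Qed.

(** * Irredundant descriptions inside the affine hull *)

Section Irredundant.
Variables (m : nat) (c : 'I_m -> 'cV[R]_(d + 1)) (k : nat).
Variable V : 'M[R]_(k.+1, d + 1).
Let P := [set x | forall i, ev x (c i) <= 0].
Hypothesis VP : affine_basis P V.

(* [lift x <= V] means that x lies in the affine hull of [P]. *)
Definition describes (I : {set 'I_m}) := forall x,
  (lift x <= V)%MS -> (forall i, i \in I -> ev x (c i) <= 0) -> P x.

(** Near [w], row [i] is the only constraint from [I] that matters in aff(P), so the face contains a
    neighbourhood of [w] in the hyperplane section and has codimension one. *)
Lemma facet_of_row (I : {set 'I_m}) i w : describes I -> V *m c i != 0 ->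
  P w -> ev w (c i) = 0 -> (forall j, j \in I -> j != i -> ev w (c j) < 0) ->
  facets P (P `&` [set x | ev x (c i) = 0]).
Proof.
move=> DI Vi Pw wi wI; set F := P `&` _.
have Fw : F w by [].
have [K [U FU]] := exists_affine_basis F.
case: K => [|K] in U FU *.
  case: FU => _ _ /(_ _ Fw) /submxP [D /eqP].
  by rewrite [U]flatmx0 mulmx0 (negPf (lift_neq0 _)).
have [Uf SU US] := FU; have [Vf SV VS] := VP.
have UW : (U <= V :&: kermx (c i))%MS.
  rewrite sub_capmx; apply/andP; split.
    by apply/row_subP => j; have [x [Px _] ->] := SU j; apply: VS.
  by apply/sub_kermxP/(affine_basis_ev0 (c i) FU) => x [].
have WU : (V :&: kermx (c i) <= U)%MS.
  apply/row_subP => j; have := row_sub j (V :&: kermx (c i))%MS.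
  move: (row _ _) => r; rewrite sub_capmx => /andP[rV /sub_kermxP ri].
  (* Subtracting this multiple of [lift w] makes the last entry 0, so [q] is a direction in which
     [w] can move. *)
  pose q := r - r 0 (rshift d 0) *: lift w.
  have q0 : q 0 (rshift d 0) = 0.
    by rewrite /q [LHS]mxE [X in _ + X]mxE [X in _ - X]mxE lift_last mulr1 subrr.
  (* Indices outside [I] and [i] itself are masked by 0, so only the rows that are strict at [w]
     limit the step. *)
  have [|j' /= |e e0 we] := @small_step _
      (fun j => if (j \in I) && (j != i) then ev w (c j) else 0)
      (fun j => if (j \in I) && (j != i) then (q *m c j) 0 0 else 0).
  - by move=> j' /=; case: ifP => // /andP[jI ji]; apply/ltW/wI.
  - by case: ifP => // /andP[jI ji] wj; have := wI _ jI ji; rewrite wj ltxx.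
  have xE : lift (lsubmx (lift w + e *: q))^T = lift w + e *: q.
    apply: lift_lsubmx; apply/rowP => l; rewrite [l]ord1.
    rewrite [LHS]mxE [LHS]mxE [X in _ + X]mxE q0 mulr0 addr0.
    by rewrite lift_last mxE.
  move: (lsubmx _)^T xE => x xE.
  have qi : (q *m c i) 0 0 = 0.
    by rewrite mulmxBl ri -scalemxAl sub0r [LHS]mxE [X in - X]mxE -/(ev w _) wi mulr0 oppr0.
  have evx j' : ev x (c j') = ev w (c j') + e * (q *m c j') 0 0.
    by rewrite /ev xE mulmxDl [LHS]mxE -scalemxAl [X in _ + X]mxE.
  have Fx : F x.
    split; last by rewrite /= evx wi qi mulr0 addr0.
    apply: DI => [|j' jI].
      rewrite xE addmx_sub ?scalemx_sub ?VS // addmx_sub // -scaleNr.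
      by rewrite scalemx_sub // VS.
    have [->|ji] := eqVneq j' i; first by rewrite evx wi qi mulr0 addr0.
    by have := we j'; rewrite jI ji /= evx.
  have qU : (q <= U)%MS.
    have -> : q = e^-1 *: (lift x - lift w).
      by rewrite xE addrC addKr scalerA mulVf ?scale1r // gt_eqF.
    by rewrite scalemx_sub // addmx_sub ?US // -scaleN1r scalemx_sub ?US.
  have -> : r = q + r 0 (rshift d 0) *: lift w by rewrite subrK.
  by rewrite addmx_sub ?scalemx_sub ?US.
have rW : \rank (V :&: kermx (c i)) = k.
  have := mxrank_mul_ker V (c i); rewrite (eqP Vf).
  have -> : \rank (V *m c i) = 1%N.
    by apply/eqP; rewrite eqn_leq rank_leq_col lt0n mxrank_eq0.
  by case.
have KE : K.+1 = k.
  by apply/eqP; rewrite -rW -{1}(eqP Uf) eqn_leq !mxrankS.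
split; first by apply/faceP; exists (c i); split=> // x; apply.
by exists K; split; apply/has_dimP; [exists U|rewrite KE; exists V].
Qed.

(** Take [I] minimal for inclusion. Dropping [i] admits a point [z] of aff(P) that violates row [i]
    alone among [I]; the segment to [z] from the barycenter [y], where all rows of [I] are strict,
    crosses the hyperplane of row [i] at [w]. *)
Lemma minimal_description : exists2 I : {set 'I_m}, describes I &
  forall i, i \in I -> V *m c i != 0 /\ exists w,
    [/\ P w, ev w (c i) = 0 & forall j, j \in I -> j != i -> ev w (c j) < 0].
Proof.
have DT : `[< describes [set: 'I_m] >].
  by apply/asboolP => x _ xc i; apply: xc; rewrite inE.
have [I /minsetP [/asboolP DI minI] _] :=
  @minset_exists _ [pred I | `[< describes I >]] _ DT.
exists I => //.
have zI i : i \in I -> exists z, [/\ (lift z <= V)%MS, 0 < ev z (c i) &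
    forall j, j \in I -> j != i -> ev z (c j) <= 0].
  move=> iI; apply: contrapT => Nz.
  suff /asboolP DIi : describes (I :\ i).
    have := minI _ DIi (subsetDl _ _) => /setP /(_ i).
    by rewrite !inE eqxx iI.
  move=> x xV xI; apply: DI => // j jI; have [->|ji] := eqVneq j i; last first.
    by apply: xI; rewrite !inE ji.
  rewrite leNgt; apply/negP => xi; apply: Nz; exists x; split=> // l lI li.
  by apply: xI; rewrite !inE li.
have VI i : i \in I -> V *m c i != 0.
  move=> /zI [z [zV zi _]]; apply/eqP => /(submx_ev zV) zi0.
  by rewrite zi0 ltxx in zi.
have [y [yV yc]] := centroid VP.
have yI i : i \in I -> ev y (c i) < 0.
  by move=> iI; apply: (yc (c i) _).2 (VI i iI) => x; apply.
move=> i iI; split; first exact: VI.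
have [z [zV zi zI']] := zI i iI; have yi := yI i iI.
pose t := - ev y (c i) / (ev z (c i) - ev y (c i)).
have D0 : 0 < ev z (c i) - ev y (c i) by lra.
have t0 : 0 < t by rewrite divr_gt0 // oppr_gt0.
have t1 : t < 1 by rewrite ltr_pdivrMr //; lra.
have wi : ev (y + t *: (z - y)) (c i) = 0.
  by rewrite ev_conv /t divfK ?gt_eqF //; lra.
have wI j : j \in I -> j != i -> ev (y + t *: (z - y)) (c j) < 0.
  move=> jI ji; rewrite ev_conv; have := yI j jI; have := zI' j jI ji; nra.
exists (y + t *: (z - y)); split=> //; apply: DI.
  by rewrite lift_conv addmx_sub // scalemx_sub // addmx_sub // -scaleN1r scalemx_sub.
move=> j jI; have [->|ji] := eqVneq j i; first by rewrite wi.
exact/ltW/wI.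
Qed.
End Irredundant.

(** Each [h j] lies in aff(P), hence violates a row [f j] of an irredundant description, and this
    row defines a facet. Distinct points give distinct facets, as no row is positive at both ends of
    a segment whose midpoint is in [P]. *)
Lemma hiding_set_card P (J : finType) (h : J -> 'cV[R]_d) k :
  polyhedron P -> P !=set0 -> facets P #= `I_k ->
  (forall j, ~ P (h j)) ->
  (forall j c, (forall x, P x -> ev x c = 0) -> ev (h j) c = 0) ->
  (forall i j, i != j -> P (h i + 2^-1 *: (h j - h i))) ->
  (#|J| <= k)%N.
Proof.
move=> /polyhedronP [m [c PE]]; subst P; set P := [set x | _].
move=> [p Pp] Pk NPh affh hid.
have [K [V VP]] := exists_affine_basis P.
case: K => [|K] in V VP *.
  case: VP => _ _ /(_ _ Pp) /submxP [D /eqP].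
  by rewrite [V]flatmx0 mulmx0 (negPf (lift_neq0 _)).
have [I DI Iw] := minimal_description VP.
have hV j : (lift (h j) <= V)%MS.
  by apply: submx_lift => a /(affine_basis_ev0 a VP); apply: affh.
have /choice [f fP] : forall j, exists i, i \in I /\ 0 < ev (h j) (c i).
  move=> j; apply: contrapT => N; apply: (NPh j); apply: DI => // i iI.
  by rewrite leNgt; apply/negP => ji; apply: N; exists i.
pose F i := P `&` [set x | ev x (c i) = 0].
have Ff j : facets P (F (f j)).
  have [fI fj] := fP j; have [Vf [w [Pw wf wI]]] := Iw _ fI.
  refine (facet_of_row VP DI Vf Pw wf wI).
have Finj : injective (F \o f).
  move=> i j /= FE; apply/eqP; apply: contraT => ij.
  have [fi hi] := fP i; have [fj hj] := fP j.
  (* Equal facets come from equal rows: [w] is on the facet of row [f i] and strictly satisfies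
     every other row of [I]. *)
  have fij : f i = f j.
    apply/eqP; apply: contraT => nf; have [_ [w [Pw wi wI]]] := Iw _ fi.
    have [_ /= wj] : F (f j) w by rewrite -FE.
    by have := wI _ fj; rewrite wj ltxx eq_sym nf => /(_ isT).
  have := hid _ _ ij (f i); rewrite ev_conv; rewrite -fij in hj; lra.
exact: (finType_card_le Finj Ff Pk).
Qed.
End Facets.

(** * Relaxation complexity of the permutahedron *)

Section IntegerPoints.
Variables (R : realType) (n : nat).
Implicit Types (x y : 'cV[int]_n).

Lemma PERM_of_injective x : (forall i, 1 <= x i 0 /\ x i 0 <= n%:Z) ->
  (forall i j, x i 0 = x j 0 -> i = j) -> PERM n x.
Proof.
move=> xb xinj.
have xn i : (`|x i 0%R|%N.-1 < n)%N by have [] := xb i; lia.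
have sinj : injective (fun i => Ordinal (xn i)).
  move=> i j [] e; apply: xinj; have [] := xb i; have [] := xb j; lia.
exists (perm sinj) => //; apply/colP => i; rewrite mxE permE /=.
by have [] := xb i; lia.
Qed.

Lemma convex_hull_conv d (S : set 'cV[R]_d) (y z : 'cV[R]_d) (t : R) :
  0 <= t <= 1 -> convex_hull S y -> convex_hull S z ->
  convex_hull S (t *: y + (1 - t) *: z).
Proof.
move=> t01 Sy Sz A [cA SA].
have /set_mem := cA y z (Itv01 (andP t01).1 (andP t01).2) (mem_set (Sy A (conj cA SA)))
  (mem_set (Sz A (conj cA SA))).
by [].
Qed.

Lemma sum_sqr_transfer x i j : i != j -> x i 0 = x j 0 ->
  \sum_k transfer i j x k 0 ^+ 2 = \sum_k x k 0 ^+ 2 + 2.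
Proof.
move=> ij xij; rewrite (bigD1 i) //= (bigD1 j) 1?eq_sym //=.
rewrite [in RHS](bigD1 i) //= [in RHS](bigD1 j) 1?eq_sym //=.
rewrite !mxE !eqxx [j == i]eq_sym (negPf ij) -xij.
rewrite (eq_bigr (fun k => x k 0 ^+ 2)); last first.
  by move=> k /andP[/negPf ki /negPf kj]; rewrite mxE ki kj addr0 subr0.
by move: (x i 0) (\sum_(_ | _) _) => a b; rewrite /=; ring.
Qed.

Lemma perm_ineqs_convex_hull x :
  perm_ineqs x -> convex_hull (@embZ R n @` PERM n) (@embZ R n x).
Proof.
(* Entries lie between 1 and [n], so n^3 bounds the sum of squares, and [gap] drops by 2 at every
   transfer. *)
pose gap (y : 'cV[int]_n) : int := (n ^ 3)%:Z - \sum_k y k 0 ^+ 2.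
have [k] := ubnP (absz (gap x)).
elim: k x => // k IH x xk xP.
have xb i := perm_ineqs_bounds i xP.
have [xinj|] := pselect (forall i j, x i 0 = x j 0 -> i = j).
  by apply: sub_gen_smallest; exists x => //; apply: PERM_of_injective.
move=> /existsNP [i] /existsNP [j] /not_implyP [xij /eqP ij].
have sq_le y : perm_ineqs y -> \sum_k y k 0 ^+ 2 <= (n ^ 3)%:Z.
  move=> yP; have -> : (n ^ 3)%:Z = \sum_(k < n) (n ^ 2)%:Z.
    rewrite sumr_const card_ord -mulr_natl; lia.
  apply: ler_sum => l _; have [] := perm_ineqs_bounds l yP.
  move: (y l 0) => a; nia.
have hT i' j' : i' != j' -> x i' 0 = x j' 0 ->
    convex_hull (@embZ R n @` PERM n) (@embZ R n (transfer i' j' x)).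
  move=> ij' xij'; have tP := perm_ineqs_transfer xP ij' xij'.
  apply: IH => //; have := sq_le _ tP; move: xk; rewrite /gap sum_sqr_transfer //.
  by lia.
have : @embZ R n x = 2^-1 *: @embZ R n (transfer i j x) + (1 - 2^-1) *: @embZ R n (transfer j i x).
  apply/colP => l; rewrite !mxE !(rmorphD, rmorphN) /=.
  lra.
move=> ->; apply: convex_hull_conv; [lra|exact: hT|by apply: hT; rewrite // eq_sym].
Qed.
End IntegerPoints.

(** * Upper and lower bounds on the number of facets *)

Section Relaxations.
Variables (R : realType) (n : nat).
Implicit Types (x : 'cV[int]_n) (y : 'cV[R]_n).

Lemma ev_sum y c : ev y c = \sum_i c (lshift 1 i) 0 * y i 0 + c (rshift n 0) 0.
Proof.
rewrite evE !mxE; congr (_ + _).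
by apply: eq_bigr => i _; rewrite !mxE.
Qed.

Lemma convex_ev_le0 (J : Type) (c : J -> 'cV[R]_(n + 1)) :
  @convex_set R 'cV[R]_n [set y | forall j, ev y (c j) <= 0].
Proof.
move=> y z t /set_mem yc /set_mem zc; apply/mem_set => j.
have [t0 t1] : 0 <= t%:num /\ t%:num <= 1 by [].
have -> : conv t y z = z + t%:num *: (y - z) :> 'cV[R]_n.
  transitivity (t%:num *: (y : 'cV[R]_n) + (1 - t%:num) *: (z : 'cV[R]_n)) => //.
  by rewrite scalerBl scale1r scalerBr addrCA.
rewrite ev_conv; have := yc j; have := zc j; nra.
Qed.

(** [None] is the upper bound on the total; with one lower bound per set of coordinates there are
    2^n + 1 rows. *)
Definition perm_facet (j : option {set 'I_n}) : 'cV[R]_(n + 1) :=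
  if j is Some T then
    col_mx (\col_i - (2 * (i \in T)%:R)) (#|T| * #|T|.+1)%:R%:M
  else col_mx (const_mx 2) (- (n * n.+1)%:R)%:M.

Lemma perm_ineqsP x :
  perm_ineqs x <-> forall j, ev (@embZ R n x) (perm_facet j) <= 0.
Proof.
have E1 T : (ev (@embZ R n x) (perm_facet (Some T)) <= 0) =
    ((#|T| * #|T|.+1)%:Z <= 2 * \sum_(i in T) x i 0).
  rewrite ev_sum col_mxEd mxE eqxx mulr1n -(ler_int R) intrM rmorph_sum /=.
  rewrite [in RHS]big_mkcond -subr_ge0 -[in RHS]oppr_le0 opprB addrC mulr_sumr -sumrN.
  congr (_ + _ <= _); apply: eq_bigr => i _; rewrite col_mxEu !mxE.
  by case: (i \in T); rewrite ?mulr1 ?mulr0 ?oppr0 ?mul0r ?mulNr.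
have E2 : (ev (@embZ R n x) (perm_facet None) <= 0) =
    (2 * \sum_i x i 0 <= (n * n.+1)%:Z).
  rewrite ev_sum col_mxEd mxE eqxx mulr1n -(ler_int R) intrM rmorph_sum /=.
  rewrite -[RHS]subr_le0 mulr_sumr.
  by congr (_ + _ <= _); apply: eq_bigr => i _; rewrite col_mxEu !mxE.
split=> [[xT xn] [T|]|xj]; rewrite ?E1 ?E2 //.
by split=> [T|]; rewrite -?E1 -?E2.
Qed.

(** The solutions of the inequalities form a convex set containing the permutations, hence their
    hull; the converse is the transfer argument. *)
Lemma convex_hull_PERM x :
  convex_hull (@embZ R n @` PERM n) (@embZ R n x) <-> perm_ineqs x.
Proof.
split; last exact: perm_ineqs_convex_hull.
move=> /(_ _ (conj (@convex_ev_le0 _ perm_facet) _)) H; apply/perm_ineqsP; apply: H.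
by move=> _ [s sP <-]; apply/perm_ineqsP/perm_ineqs_PERM.
Qed.

Lemma relaxation_permutahedron :
  relaxation (PERM n) [set y : 'cV[R]_n | forall j, ev y (perm_facet j) <= 0].
Proof.
split; first exact: polyhedron_finType.
apply/seteqP; split=> y [yP [x _ xy]]; subst y; split; try by exists x.
  exact/convex_hull_PERM/perm_ineqsP.
exact/perm_ineqsP/convex_hull_PERM.
Qed.

Lemma rc_PERM_le : (rc R (PERM n) <= ((2 ^ n).+1%:R)%:E)%E.
Proof.
pose c (i : 'I_#|{: option {set 'I_n}}|) := perm_facet (enum_val i).
have [k km kP] := facets_card c.
apply: ge_ereal_inf; exists (k%:R)%:E; last first.
  rewrite lee_fin ler_nat (leq_trans km) //.
  by rewrite card_option -cardsT -powersetT card_powerset cardsT card_ord.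
exists k => //; exists [set y | forall j, ev y (perm_facet j) <= 0].
split; first exact: relaxation_permutahedron.
suff -> : [set y | forall j, ev y (perm_facet j) <= 0] =
  [set y | forall i, ev y (c i) <= 0] by [].
apply/seteqP; split=> y /= yc j; first exact: yc.
by rewrite -[j]enum_rankK; apply: yc.
Qed.

(** Comparing the identity with the transposition of [i] and [j] gives (a i - a j)(j - i) = 0, so
    all coefficients agree and the function depends on the coordinate sum only. *)
Lemma ev_PERM_total (c : 'cV[R]_(n + 1)) x : (0 < n)%N ->
  (forall s, PERM n s -> ev (@embZ R n s) c = 0) ->
  2 * \sum_i x i 0 = (n * n.+1)%:Z -> ev (@embZ R n x) c = 0.
Proof.
move=> n0 Pc xn; pose a i := c (lshift 1 i) 0.
have Ps (s : 'S_n) : \sum_i a i * (s i).+1%:R + c (rshift n 0) 0 = 0.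
  rewrite -[RHS](Pc (\col_i ((s i).+1)%:Z)); last by exists s.
  by rewrite ev_sum; congr (_ + _); apply: eq_bigr => i _; rewrite !mxE.
have aE i j : a i = a j.
  have [->//|ij] := eqVneq i j.
  have := etrans (Ps (tperm i j)) (esym (Ps 1%g)).
  move/addIr; rewrite (bigD1 i) //= (bigD1 j) 1?eq_sym //=.
  rewrite [in RHS](bigD1 i) //= [in RHS](bigD1 j) 1?eq_sym //=.
  rewrite tpermL tpermR !perm1.
  rewrite (eq_bigr (fun k => a k * ((1%g : 'S_n) k).+1%:R)); last first.
    by move=> k /andP[ki kj]; rewrite tpermD 1?eq_sym ?perm1.
  move=> /eqP; rewrite !addrA (inj_eq (addIr _)) -subr_eq0 => e.
  have : (a i - a j) * (j%:R - i%:R) = 0 by rewrite -[RHS](eqP e) -!natr1; ring.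
  move=> /eqP; rewrite mulf_eq0 !subr_eq0 => /orP[/eqP//|].
  by rewrite eqr_nat => /eqP ji; rewrite (ord_inj ji) eqxx in ij.
rewrite ev_sum -[RHS](Ps 1%g); congr (_ + _).
pose i0 := Ordinal n0.
rewrite (eq_bigr (fun i => a i0 * (x i 0)%:~R)); last first.
  by move=> i _; rewrite mxE -/(a i) (aE i i0).
rewrite [RHS](eq_bigr (fun i : 'I_n => a i0 * i.+1%:R)); last first.
  by move=> i _; rewrite (aE i i0) perm1.
rewrite -!mulr_sumr; congr (_ * _).
have := congr1 (fun z : int => z%:~R : R) xn.
rewrite /= -double_sum_succ PoszM !rmorphM /= -rmorph_sum /=.
move=> /(mulfI _) ->; first by rewrite -natr_sum.
by rewrite pnatr_eq0.
Qed.

(** A function on all naturals, as [spread] expects; indices from [m] on get -1. *)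
Definition sign_vector m (f : {ffun 'I_m -> bool}) k : int :=
  if oapp f false (insub k) then 1 else -1.

Lemma sign_vectorE m (f : {ffun 'I_m -> bool}) (k : 'I_m) :
  sign_vector f k = if f k then 1 else -1.
Proof. by rewrite /sign_vector valK. Qed.

Lemma relaxation_facets_ge (P : set 'cV[R]_n) k p : (0 < p)%N -> (4 * p < n)%N ->
  relaxation (PERM n) P -> facets P #= `I_k -> (2 ^ (2 * p) <= k)%N.
Proof.
move=> p0 pn [Ppoly PX] Pk.
have PE x : P (@embZ R n x) <-> perm_ineqs x.
  have /seteqP [PX1 PX2] := PX.
  split=> [Px|/convex_hull_PERM xh].
    by apply/convex_hull_PERM; apply: (PX1 _ (conj Px _)).1; exists x.
  by apply: (PX2 _ (conj xh _)).1; exists x.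
have pn' : (2 * (2 * p) < n)%N by lia.
have PP s : PERM n s -> P (@embZ R n s) by move=> /perm_ineqs_PERM /PE.
pose h (f : {ffun 'I_(2 * p) -> bool}) := @embZ R n (hpoint n p (sign_vector f)).
have -> : (2 ^ (2 * p) = #|{ffun 'I_(2 * p) -> bool}|)%N.
  by rewrite card_ffun card_bool card_ord.
apply: (hiding_set_card (h := h) Ppoly _ Pk) => [|f|f c Pc|f g fg].
- by exists (@embZ R n (\col_i ((1%g : 'S_n) i).+1%:Z)); apply: PP; exists 1%g.
- move=> /PE; apply: hpoint_notin => // i im.
  by rewrite -[i]/(val (Ordinal im)) sign_vectorE; case: (f _); [left|right].
- apply: ev_PERM_total; first by lia.
    by move=> s /PP; apply: Pc.
  exact: hpoint_total.
- have /existsP [k0 fgk] : [exists k0, f k0 != g k0].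
    rewrite -negb_forall; apply: contra fg => /forallP fg.
    by apply/eqP/ffunP => i; apply/eqP.
  (* The mean of the two sign vectors is integral and vanishes where they differ, in particular at
     [k0]. *)
  pose u i := if sign_vector f i == sign_vector g i then sign_vector f i else 0.
  have uE i : sign_vector f i + sign_vector g i = 2 * u i.
    by rewrite /u /sign_vector; case: (oapp _ _ _); case: (oapp _ _ _).
  have -> : h f + 2^-1 *: (h g - h f) = @embZ R n (hpoint n p u).
    apply/colP => i; rewrite !mxE.
    have : spread p (sign_vector f) i + spread p (sign_vector g) i = 2 * spread p u i.
      rewrite /spread; case: ifP => // _; case: ifP => // _.
      by rewrite -opprD uE mulrN.
    move/(congr1 (fun z : int => z%:~R : R)); rewrite !(rmorphD, rmorphM, rmorphN) /=.
    move=> e; set sf := (spread _ _ _)%:~R in e *.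
    set sg := (spread _ (sign_vector g) _)%:~R in e *.
    nra.
  apply/PE; apply: (perm_ineqs_hpoint pn' (ltn_ord k0)).
    by rewrite /u !sign_vectorE; move: fgk; case: (f k0); case: (g k0).
  by move=> i im; rewrite /u /sign_vector; case: (_ == _) => //; case: ifP.
Qed.
End Relaxations.

Theorem theorem6 (R : realType) : two_pow_Theta (fun n : nat => rc R (PERM n)).
Proof.
exists (8^-1), 2; split; first by rewrite invr_gt0.
split; first by [].
exists 8%N => // n /= n8; split.
  (* From 8p <= n < 16p follow 4p < n, as the hiding set requires, and n/8 <= 2p. *)
  pose p := (n %/ 8)%N.
  have p0 : (0 < p)%N by rewrite divn_gt0.
  have [np1 np2] : (8 * p <= n)%N /\ (n < 16 * p)%N by rewrite /p; lia.
  apply: le_ereal_inf_tmp => _ [k [P [PX Pk]] <-].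
  rewrite lee_fin; have := @relaxation_facets_ge R n P k p p0 _ PX Pk.
  move=> /(_ ltac:(lia)) kp.
  apply: (@le_trans _ _ (2 `^ (2 * p)%:R)).
    rewrite ler_powR ?ler1n // mulrC ler_pdivrMr // -natrM ler_nat; lia.
  by rewrite powR_mulrn // -natrX ler_nat.
apply: (le_trans (rc_PERM_le R n)); rewrite lee_fin -natrM powR_mulrn // -natrX ler_nat.
(* With a = 2^n >= 2, the bound is a + 1 <= a^2. *)
rewrite mulnC expnM; have : (2 <= 2 ^ n)%N by rewrite -{1}[2%N]expn1 leq_exp2l //; lia.
move: (2 ^ n)%N => a a2; rewrite -mulnn; nia.
Qed.
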